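(* For every intuitionistic formula $A$: every proof of $\ \Rightarrow w:A$ in $\mathsf{L(IL)}$ can be step-wise translated into a proof of the nested sequent $\ \Rightarrow A$ in $\mathsf{N(IL)}$. In particular, if $\Rightarrow w:A$ is provable in $\mathsf{L(IL)}$ then $\Rightarrow A$ is provable in $\mathsf{N(IL)}$.
   Context: Intuitionistic formulas: $A::=p\mid\bot\mid A\lor A\mid A\land A\mid A\supset A$. $\mathsf{L(IL)}$ works on labeled sequents $\mathcal{R},\Gamma\Rightarrow\Delta$ ($\mathcal{R}$ multiset of atoms $w\le u$; $\Gamma,\Delta$ multisets of labeled formulas $w:A$) with rules: $(id)$ $\mathcal{R},w\le u,\Gamma,w:p\Rightarrow u:p,\Delta$; $(\bot_l)$ $\mathcal{R},w\le u,\Gamma,w:\bot\Rightarrow\Delta$; $(\supset_r)$ from $\mathcal{R},w\le u,\Gamma,u:A\Rightarrow u:B,\Delta$ infer $\mathcal{R},\Gamma\Rightarrow w:A\supset B,\Delta$, $u$ fresh; $(\lor_l)$ from $\mathcal{R},\Gamma,w:A\Rightarrow\Delta$ and $\mathcal{R},\Gamma,w:B\Rightarrow\Delta$ infer $\mathcal{R},\Gamma,w:A\lor B\Rightarrow\Delta$; $(\lor_r)$ from $\mathcal{R},\Gamma\Rightarrow w:A,w:B,\Delta$ infer $\mathcal{R},\Gamma\Rightarrow w:A\lor B,\Delta$; $(\land_l)$ from $\mathcal{R},\Gamma,w:A,w:B\Rightarrow\Delta$ infer $\mathcal{R},\Gamma,w:A\land B\Rightarrow\Delta$; $(\land_r)$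 from $\mathcal{R},\Gamma\Rightarrow w:A,\Delta$ and $\mathcal{R},\Gamma\Rightarrow w:B,\Delta$ infer $\mathcal{R},\Gamma\Rightarrow w:A\land B,\Delta$; $(\supset_l)$ from $\mathcal{R},w\le u,\Gamma,w:A\supset B,u:B\Rightarrow\Delta$ and $\mathcal{R},w\le u,\Gamma,w:A\supset B\Rightarrow u:A,\Delta$ infer $\mathcal{R},w\le u,\Gamma,w:A\supset B\Rightarrow\Delta$; $(ref)$ from $\mathcal{R},w\le w,\Gamma\Rightarrow\Delta$ infer $\mathcal{R},\Gamma\Rightarrow\Delta$; $(tra)$ from $\mathcal{R},w\le u,u\le v,w\le v,\Gamma\Rightarrow\Delta$ infer $\mathcal{R},w\le u,u\le v,\Gamma\Rightarrow\Delta$. Nested sequents of $\mathsf{N(IL)}$ have the form $\Gamma\Rightarrow\Delta,[\Sigma_1]_{w_1},\dots,[\Sigma_n]_{w_n}$ with $\Gamma,\Delta$ multisets of formulas and $\Sigma_i$ nested sequents; they encode trees whose nodes are sequents $\Gamma\Rightarrow\Delta$, each node carrying a distinct name (the root named $r$). $\Sigma\{\Gamma\Rightarrow\Delta\}_w$ denotes a nested sequent with node $w$ containing $\Gamma\Rightarrow\Delta$, and $\Sigma\{\cdot\}_w\{\cdot\}_u$ displays two nodes; ''$u$ is reachable from $w$'' means there is a (possibly length-0) downward path from $w$ to $u$ in the tree. Rules of $\mathsf{N(IL)}$: $(id)$ $\Sigma\{\Gamma_1,p\Rightarrow\Delta_1\}_w\{\Gamma_2\Rightarrow p,\Delta_2\}_u$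 ($u$ reachable from $w$; if $u=w$ this means $p$ occurs on both sides of one node); $(\bot_l)$ $\Sigma\{\Gamma,\bot\Rightarrow\Delta\}_w$; $(\lor_l),(\lor_r),(\land_l),(\land_r)$ as the sequent rules applied inside a node $\Sigma\{\cdot\}_w$; $(\supset_l)$ from $\Sigma\{\Gamma_1,A\supset B\Rightarrow\Delta_1\}_w\{\Gamma_2,B\Rightarrow\Delta_2\}_u$ and $\Sigma\{\Gamma_1,A\supset B\Rightarrow\Delta_1\}_w\{\Gamma_2\Rightarrow A,\Delta_2\}_u$ infer $\Sigma\{\Gamma_1,A\supset B\Rightarrow\Delta_1\}_w\{\Gamma_2\Rightarrow\Delta_2\}_u$ ($u$ reachable from $w$); $(\supset_r)$ from $\Sigma\{\Gamma\Rightarrow\Delta,[A\Rightarrow B]_u\}_w$ infer $\Sigma\{\Gamma\Rightarrow\Delta,A\supset B\}_w$ ($u$ a fresh name). *)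

(* Defs.v *)
(* Multisets are lists; every rule
   picks its principal formulas up to Permutation / membership, so
   derivability depends only on the underlying multisets. *)
From Stdlib Require Import List Permutation.
Import ListNotations.

Inductive form : Type :=
| Var : nat -> form
| Bot : form
| Or  : form -> form -> form
| And : form -> form -> form
| Imp : form -> form -> form.

Definition label := nat.
Definition lform := (label * form)%type.
Definition rel_atom := (label * label)%type. (* w <= u *)

Definition labels_R (R : list rel_atom) : list label :=
  flat_map (fun p => [fst p; snd p]) R.
Definition labels_F (G : list lform) : list label := map fst G.

Inductive LProv : list rel_atom -> list lform -> list lform -> Prop :=
| L_id : forall R G D w u p,
    In (w, u) R -> In (w, Var p) G -> In (u, Var p) D -> LProv R G D
| L_botl : forall R G D w u,
    In (w, u) R -> In (w, Bot) G -> LProv R G D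
| L_impr : forall R G D D' w u A B,
    Permutation D ((w, Imp A B) :: D') ->
    ~ In u (labels_R R) -> ~ In u (labels_F G) -> ~ In u (labels_F D) ->
    LProv ((w, u) :: R) ((u, A) :: G) ((u, B) :: D') ->
    LProv R G D
| L_orl : forall R G G' D w A B,
    Permutation G ((w, Or A B) :: G') ->
    LProv R ((w, A) :: G') D -> LProv R ((w, B) :: G') D -> LProv R G D
| L_orr : forall R G D D' w A B,
    Permutation D ((w, Or A B) :: D') ->
    LProv R G ((w, A) :: (w, B) :: D') -> LProv R G D
| L_andl : forall R G G' D w A B,
    Permutation G ((w, And A B) :: G') ->
    LProv R ((w, A) :: (w, B) :: G') D -> LProv R G D
| L_andr : forall R G D D' w A B,
    Permutation D ((w, And A B) :: D') ->
    LProv R G ((w, A) :: D') -> LProv R G ((w, B) :: D') -> LProv R G D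
| L_impl : forall R G D w u A B,
    In (w, u) R -> In (w, Imp A B) G ->
    LProv R ((u, B) :: G) D -> LProv R G ((u, A) :: D) -> LProv R G D
| L_ref : forall R G D w,
    LProv ((w, w) :: R) G D -> LProv R G D
| L_tra : forall R G D w u v,
    In (w, u) R -> In (u, v) R ->
    LProv ((w, v) :: R) G D -> LProv R G D.

(* A nested sequent: a tree whose nodes carry a name and a sequent
   Gamma => Delta; Node w G D ch  is  G => D, [ch_1]_{w1}, ..., [ch_n]_{wn}
   with the node named w. *)
Inductive nseq : Type :=
| Node : nat -> list form -> list form -> list nseq -> nseq.

Fixpoint names (t : nseq) : list nat :=
  match t with
  | Node w _ _ ch => w :: flat_map names ch
  end.

Inductive nctx : Type :=
| Hole : nctx
| CNode : nat -> list form -> list form -> list nseq -> nctx -> list nseq -> nctx.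

Fixpoint plug (C : nctx) (t : nseq) : nseq :=
  match C with
  | Hole => t
  | CNode w G D l C' r => Node w G D (l ++ plug C' t :: r)
  end.

(* Two displayed nodes  Sigma{G1 => D1}_w{G2 => D2}_u  with u a proper
   descendant of w (u reachable from w by a path of length >= 1):
     plug C (Node w G1 D1 (l ++ plug E (Node u G2 D2 ch2) :: r) ) *)
Definition two (C : nctx) (w : nat) (G1 D1 : list form) (l : list nseq)
  (E : nctx) (u : nat) (G2 D2 : list form) (ch2 r : list nseq) : nseq :=
  plug C (Node w G1 D1 (l ++ plug E (Node u G2 D2 ch2) :: r)).

Inductive NProv : nseq -> Prop :=
(* (id), u = w *)
| N_id_same : forall C w G D ch p,
    In (Var p) G -> In (Var p) D -> NProv (plug C (Node w G D ch))
(* (id), u a proper descendant of w *)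
| N_id_desc : forall C w G1 D1 l E u G2 D2 ch2 r p,
    In (Var p) G1 -> In (Var p) D2 ->
    NProv (two C w G1 D1 l E u G2 D2 ch2 r)
| N_botl : forall C w G D ch,
    In Bot G -> NProv (plug C (Node w G D ch))
| N_orl : forall C w G G' D ch A B,
    Permutation G (Or A B :: G') ->
    NProv (plug C (Node w (A :: G') D ch)) ->
    NProv (plug C (Node w (B :: G') D ch)) ->
    NProv (plug C (Node w G D ch))
| N_orr : forall C w G D D' ch A B,
    Permutation D (Or A B :: D') ->
    NProv (plug C (Node w G (A :: B :: D') ch)) ->
    NProv (plug C (Node w G D ch))
| N_andl : forall C w G G' D ch A B,
    Permutation G (And A B :: G') ->
    NProv (plug C (Node w (A :: B :: G') D ch)) ->
    NProv (plug C (Node w G D ch))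
| N_andr : forall C w G D D' ch A B,
    Permutation D (And A B :: D') ->
    NProv (plug C (Node w G (A :: D') ch)) ->
    NProv (plug C (Node w G (B :: D') ch)) ->
    NProv (plug C (Node w G D ch))
(* (imp_l), u = w *)
| N_impl_same : forall C w G D ch A B,
    In (Imp A B) G ->
    NProv (plug C (Node w (B :: G) D ch)) ->
    NProv (plug C (Node w G (A :: D) ch)) ->
    NProv (plug C (Node w G D ch))
(* (imp_l), u a proper descendant of w *)
| N_impl_desc : forall C w G1 D1 l E u G2 D2 ch2 r A B,
    In (Imp A B) G1 ->
    NProv (two C w G1 D1 l E u (B :: G2) D2 ch2 r) ->
    NProv (two C w G1 D1 l E u G2 (A :: D2) ch2 r) ->
    NProv (two C w G1 D1 l E u G2 D2 ch2 r)
| N_impr : forall C w G D D' ch u A B,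
    Permutation D (Imp A B :: D') ->
    ~ In u (names (plug C (Node w G D ch))) ->
    NProv (plug C (Node w G D' (Node u [A] [B] [] :: ch))) ->
    NProv (plug C (Node w G D ch)).

Definition root_name : nat := 0.

(* Main.v *)
(* An L(IL) derivation is translated rule by rule, from the root upwards. Along a branch we
   keep a tree [s] of node names and a map [f] from labels to nodes such that every atom
   [w <= u] goes to nodes with [f u] reachable from [f w]; the nested sequent is [s] with
   each labelled formula [x : A] placed at node [f x]. Propositional rules then act inside a
   single node, (id) and (imp_l) become the nested rules for a node and a node reachable
   from it, (ref) and (tra) are absorbed by reflexivity and transitivity of reachability,
   and the eigenlabel of (imp_r) is sent to a fresh leaf below [f w], which is precisely the
   nested (imp_r). The end sequent [=> w : A] starts from the one-node tree. *)

Require Import Defs.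
From Stdlib Require Import List Permutation Arith Lia.
Import ListNotations.

Inductive skel : Type := SNode : nat -> list skel -> skel.

Fixpoint snames (s : skel) : list nat :=
  match s with SNode n ch => n :: flat_map snames ch end.

Section SkelNestedInd.
Variable P : skel -> Prop.
Hypothesis HP : forall n ch, (forall c, In c ch -> P c) -> P (SNode n ch).

Fixpoint skel_nested_ind (s : skel) : P s :=
  match s with
  | SNode n ch => HP n ch ((fix F (l : list skel) : forall c, In c l -> P c :=
       match l with
       | [] => fun c H => False_ind _ H
       | x :: xs => fun c H => match H with
                     | or_introl e => eq_ind x P (skel_nested_ind x) c e
                     | or_intror H' => F xs c H'
                     end
       end) ch)
  end.
End SkelNestedInd.

Inductive sctx : Type :=
| SHole : sctx
| SCNode : nat -> list skel -> sctx -> list skel -> sctx.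

Fixpoint splug (K : sctx) (t : skel) : skel :=
  match K with
  | SHole => t
  | SCNode n l K' r => SNode n (l ++ splug K' t :: r)
  end.

Fixpoint cnames (K : sctx) : list nat :=
  match K with
  | SHole => []
  | SCNode n l K' r => n :: flat_map snames l ++ cnames K' ++ flat_map snames r
  end.

Fixpoint scomp (K1 K2 : sctx) : sctx :=
  match K1 with
  | SHole => K2
  | SCNode n l K r => SCNode n l (scomp K K2) r
  end.

Lemma splug_scomp K1 K2 t : splug (scomp K1 K2) t = splug K1 (splug K2 t).
Proof. induction K1 as [|n l K1 IH r]; simpl; [reflexivity|now rewrite IH]. Qed.

Lemma snames_splug K t : Permutation (snames (splug K t)) (cnames K ++ snames t).
Proof.
  induction K as [|n l K IH r]; simpl; [reflexivity|].
  constructor. rewrite flat_map_app. simpl. rewrite <- !app_assoc.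
  apply Permutation_app_head.
  rewrite IH, <- app_assoc. apply Permutation_app_head, Permutation_app_comm.
Qed.

Lemma in_snames_splug K t x : In x (snames t) -> In x (snames (splug K t)).
Proof.
  intro H. eapply Permutation_in; [symmetry; apply snames_splug|].
  apply in_or_app; now right.
Qed.

Lemma in_flat_map_snames l c x : In c l -> In x (snames c) -> In x (flat_map snames l).
Proof. intros; apply in_flat_map; eauto. Qed.

Lemma NoDup_app_disjoint {A} (l1 l2 : list A) x : NoDup (l1 ++ l2) -> In x l1 -> ~ In x l2.
Proof.
  intros ND H1 H2. destruct (in_split _ _ H1) as [a [b ->]].
  rewrite <- app_assoc in ND. apply (NoDup_remove_2 _ _ _ ND).
  rewrite !in_app_iff; auto.
Qed.

Lemma NoDup_splug K t : NoDup (snames (splug K t)) ->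
  NoDup (snames t) /\ (forall x, In x (snames t) -> ~ In x (cnames K)).
Proof.
  intro ND. apply (Permutation_NoDup (snames_splug K t)) in ND. split.
  - exact (NoDup_app_remove_l _ _ ND).
  - intros x Ht Hc. exact (NoDup_app_disjoint _ _ x ND Hc Ht).
Qed.

Lemma splug_at_name s b : In b (snames s) -> exists K ch, s = splug K (SNode b ch).
Proof.
  induction s as [n ch IH] using skel_nested_ind. simpl. intros [<-|H].
  - now exists SHole, ch.
  - apply in_flat_map in H as [c [Hc Hb]].
    destruct (IH c Hc Hb) as [K [ch' ->]].
    destruct (in_split _ _ Hc) as [l [r ->]].
    now exists (SCNode n l K r), ch'.
Qed.

Lemma child_eq_of_shared_name (l1 r1 l2 r2 : list skel) x1 x2 a :
  l1 ++ x1 :: r1 = l2 ++ x2 :: r2 -> NoDup (flat_map snames (l1 ++ x1 :: r1)) ->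
  In a (snames x1) -> In a (snames x2) -> x1 = x2.
Proof.
  revert l2. induction l1 as [|y l1 IH]; intros [|z l2]; simpl; intros E ND H1 H2.
  - now injection E.
  - injection E as -> ->. exfalso.
    apply (NoDup_app_disjoint _ _ a ND H1), (in_flat_map_snames _ x2); auto.
    apply in_or_app; right; now left.
  - injection E as -> <-. exfalso.
    apply (NoDup_app_disjoint _ _ a ND H2), (in_flat_map_snames _ x1); auto.
    apply in_or_app; right; now left.
  - injection E as <- E. eapply IH; eauto. eapply NoDup_app_remove_l; eauto.
Qed.

Lemma NoDup_snames_child (l r : list skel) x :
  NoDup (flat_map snames (l ++ x :: r)) -> NoDup (snames x).
Proof.
  rewrite flat_map_app. simpl. intro H.
  exact (NoDup_app_remove_r _ _ (NoDup_app_remove_l _ _ H)).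
Qed.

Lemma splug_name_inj K1 K2 a c1 c2 :
  splug K1 (SNode a c1) = splug K2 (SNode a c2) ->
  NoDup (snames (splug K1 (SNode a c1))) -> c1 = c2.
Proof.
  revert K2. induction K1 as [|n1 l1 K1 IH r1]; intros [|n2 l2 K2 r2]; simpl; intros E ND.
  - now injection E.
  - injection E as <- ->. inversion ND as [|? ? Hn _]. exfalso. apply Hn.
    apply (in_flat_map_snames _ (splug K2 (SNode a c2))).
    + apply in_or_app; right; now left.
    + apply in_snames_splug; now left.
  - injection E as -> <-. inversion ND as [|? ? Hn _]. exfalso. apply Hn.
    apply (in_flat_map_snames _ (splug K1 (SNode a c1))).
    + apply in_or_app; right; now left.
    + apply in_snames_splug; now left.
  - injection E as <- E. inversion ND as [|? ? _ ND'].
    apply (IH K2).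
    + eapply child_eq_of_shared_name; eauto; apply in_snames_splug; now left.
    + eapply NoDup_snames_child; eauto.
Qed.

Definition reach (s : skel) (a b : nat) : Prop :=
  exists K ch, s = splug K (SNode a ch) /\ In b (snames (SNode a ch)).

(* [reach s a a] needs [a] to be a node of [s]; labels introduced by (ref) need not be. *)
Definition reach_or_eq (s : skel) (a b : nat) : Prop := a = b \/ reach s a b.

Lemma reach_in_snames s a b : reach s a b -> In b (snames s).
Proof. intros [K [ch [-> H]]]. now apply in_snames_splug. Qed.

Lemma reach_trans s a b c : NoDup (snames s) -> reach s a b -> reach s b c -> reach s a c.
Proof.
  intros ND [K1 [ch1 [E1 H1]]] [K2 [ch2 [E2 H2]]].
  destruct (splug_at_name _ _ H1) as [K3 [ch3 E3]].
  assert (E4 : s = splug (scomp K1 K3) (SNode b ch3)) by now rewrite splug_scomp, <- E3.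
  assert (ch3 = ch2) as ->.
  { apply (splug_name_inj (scomp K1 K3) K2 b); rewrite <- E4; assumption. }
  exists K1, ch1. split; [assumption|]. rewrite E3. now apply in_snames_splug.
Qed.

Lemma reach_or_eq_trans s a b c : NoDup (snames s) ->
  reach_or_eq s a b -> reach_or_eq s b c -> reach_or_eq s a c.
Proof.
  intros ND [->|H1] [->|H2]; unfold reach_or_eq; auto.
  right; eapply reach_trans; eauto.
Qed.

Lemma reach_split s a b : reach s a b -> a <> b ->
  exists K l K2 ch2 r, s = splug K (SNode a (l ++ splug K2 (SNode b ch2) :: r)).
Proof.
  intros [K [ch [-> [Hab|H]]]] Hne; [congruence|].
  apply in_flat_map in H as [c [Hc Hb]].
  destruct (splug_at_name _ _ Hb) as [K2 [ch2 ->]].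
  destruct (in_split _ _ Hc) as [l [r ->]].
  now exists K, l, K2, ch2, r.
Qed.

Section Graft.
Variables (a : nat) (t : skel).

Fixpoint graft (s : skel) : skel :=
  match s with
  | SNode n ch => SNode n (if Nat.eqb n a then t :: map graft ch else map graft ch)
  end.

Fixpoint cgraft (K : sctx) : sctx :=
  match K with
  | SHole => SHole
  | SCNode n l K' r =>
      SCNode n (if Nat.eqb n a then t :: map graft l else map graft l) (cgraft K') (map graft r)
  end.

Lemma graft_splug K s : graft (splug K s) = splug (cgraft K) (graft s).
Proof.
  induction K as [|n l K IH r]; simpl; [reflexivity|].
  rewrite !map_app; simpl; rewrite IH. now destruct (Nat.eqb n a).
Qed.

Lemma graft_notin s : ~ In a (snames s) -> graft s = s.
Proof.
  induction s as [n ch IH] using skel_nested_ind. simpl. intros H.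
  destruct (Nat.eqb_spec n a) as [->|_]; [exfalso; apply H; now left|].
  f_equal. rewrite <- (map_id ch) at 2. apply map_ext_in. intros c Hc.
  apply IH; [assumption|]. intro H'. apply H. right. exact (in_flat_map_snames _ _ _ Hc H').
Qed.

Lemma map_graft_notin l : ~ In a (flat_map snames l) -> map graft l = l.
Proof.
  intro H. rewrite <- (map_id l) at 2. apply map_ext_in. intros c Hc.
  apply graft_notin. intro H'. exact (H (in_flat_map_snames _ _ _ Hc H')).
Qed.

Lemma cgraft_notin K : ~ In a (cnames K) -> cgraft K = K.
Proof.
  induction K as [|n l K IH r]; simpl; intros H; [reflexivity|].
  destruct (Nat.eqb_spec n a) as [->|_]; [exfalso; apply H; now left|].
  rewrite !map_graft_notin, IH; [reflexivity|..];
    intro H'; apply H; right; rewrite !in_app_iff; auto.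
Qed.

Lemma in_snames_graft s x : In x (snames s) -> In x (snames (graft s)).
Proof.
  induction s as [n ch IH] using skel_nested_ind. simpl. intros [->|H]; [now left|right].
  apply in_flat_map in H as [c [Hc Hx]].
  assert (Hc' : In (graft c) (map graft ch)) by now apply in_map.
  destruct (Nat.eqb n a); simpl; [apply in_or_app; right|];
    exact (in_flat_map_snames _ _ _ Hc' (IH c Hc Hx)).
Qed.

Lemma reach_graft s x y : reach s x y -> reach (graft s) x y.
Proof.
  intros [K [ch [-> H]]].
  exists (cgraft K), (if Nat.eqb x a then t :: map graft ch else map graft ch).
  split; [apply graft_splug|exact (in_snames_graft (SNode x ch) y H)].
Qed.
End Graft.

Lemma graft_at K a ch t : NoDup (snames (splug K (SNode a ch))) ->
  graft a t (splug K (SNode a ch)) = splug K (SNode a (t :: ch)).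
Proof.
  intros ND. destruct (NoDup_splug _ _ ND) as [ND1 Hdis].
  rewrite graft_splug, cgraft_notin by (apply Hdis; now left).
  simpl. rewrite Nat.eqb_refl, map_graft_notin; [reflexivity|].
  now inversion ND1.
Qed.

Section Build.
Variables (g d : nat -> list form).

Fixpoint build (s : skel) : nseq :=
  match s with SNode n ch => Node n (g n) (d n) (map build ch) end.

Fixpoint bctx (K : sctx) : nctx :=
  match K with
  | SHole => Hole
  | SCNode n l K' r => CNode n (g n) (d n) (map build l) (bctx K') (map build r)
  end.

Lemma build_splug K t : build (splug K t) = plug (bctx K) (build t).
Proof.
  induction K as [|n l K IH r]; simpl; [reflexivity|].
  rewrite map_app; simpl; now rewrite IH.
Qed.

Lemma bctx_scomp K1 K2 t : plug (bctx (scomp K1 K2)) t = plug (bctx K1) (plug (bctx K2) t).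
Proof. induction K1 as [|n l K1 IH r]; simpl; [reflexivity|now rewrite IH]. Qed.

Lemma names_build s : names (build s) = snames s.
Proof.
  induction s as [n ch IH] using skel_nested_ind. simpl. f_equal.
  induction ch as [|c ch IHch]; simpl; [reflexivity|].
  rewrite IH by now left. rewrite IHch; [reflexivity|].
  intros c' Hc'; apply IH; now right.
Qed.
End Build.

Lemma build_ext_in g d g' d' s :
  (forall m, In m (snames s) -> g' m = g m /\ d' m = d m) -> build g' d' s = build g d s.
Proof.
  induction s as [n ch IH] using skel_nested_ind. intros H. simpl.
  destruct (H n) as [-> ->]; [now left|]. f_equal.
  apply map_ext_in. intros c Hc. apply IH; [assumption|].
  intros m Hm. apply H. right. exact (in_flat_map_snames _ _ _ Hc Hm).
Qed.

Lemma map_build_ext_in g d g' d' l :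
  (forall m, In m (flat_map snames l) -> g' m = g m /\ d' m = d m) ->
  map (build g' d') l = map (build g d) l.
Proof.
  intros H. apply map_ext_in. intros c Hc. apply build_ext_in.
  intros m Hm. apply H. exact (in_flat_map_snames _ _ _ Hc Hm).
Qed.

Lemma bctx_ext_in g d g' d' K :
  (forall m, In m (cnames K) -> g' m = g m /\ d' m = d m) -> bctx g' d' K = bctx g d K.
Proof.
  induction K as [|n l K IH r]; simpl; intros H; [reflexivity|].
  destruct (H n) as [-> ->]; [now left|].
  rewrite (map_build_ext_in g d g' d' l), (map_build_ext_in g d g' d' r), IH;
    [reflexivity|..]; intros m Hm; apply H; right; rewrite !in_app_iff; tauto.
Qed.

Lemma build_splug_focus K b ch g d g' d' :
  NoDup (snames (splug K (SNode b ch))) ->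
  (forall m, m <> b -> g' m = g m) -> (forall m, m <> b -> d' m = d m) ->
  build g' d' (splug K (SNode b ch)) =
  plug (bctx g d K) (Node b (g' b) (d' b) (map (build g d) ch)).
Proof.
  intros ND Hg Hd. destruct (NoDup_splug _ _ ND) as [ND1 Hdis].
  rewrite build_splug. simpl. f_equal; [|f_equal].
  - apply bctx_ext_in. intros m Hm.
    assert (m <> b) by (intros ->; exact (Hdis b (or_introl eq_refl) Hm)). auto.
  - apply map_build_ext_in. intros m Hm.
    assert (m <> b) by (intros ->; now inversion ND1). auto.
Qed.

(* A rule changes only the contents of the displayed node, so one display [C], [chs]
   serves its conclusion and its premises. *)
Definition focused (s : skel) (g d : nat -> list form) (a : nat) (C : nctx) (chs : list nseq)
  : Prop :=
  forall g' d', (forall m, m <> a -> g' m = g m) -> (forall m, m <> a -> d' m = d m) ->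
    build g' d' s = plug C (Node a (g' a) (d' a) chs).

Lemma focused_self s g d a C chs :
  focused s g d a C chs -> build g d s = plug C (Node a (g a) (d a) chs).
Proof. intro H. now apply H. Qed.

Lemma build_focus s g d a : NoDup (snames s) -> In a (snames s) ->
  exists C chs, focused s g d a C chs.
Proof.
  intros ND Ha. destruct (splug_at_name s a Ha) as [K [ch ->]].
  exists (bctx g d K), (map (build g d) ch). intros g' d'.
  now apply build_splug_focus.
Qed.

Definition focused2 (s : skel) (g d : nat -> list form) (a b : nat)
  (C : nctx) (l : list nseq) (E : nctx) (ch2 r : list nseq) : Prop :=
  forall g' d', (forall m, m <> b -> g' m = g m) -> (forall m, m <> b -> d' m = d m) ->
    build g' d' s = two C a (g a) (d a) l E b (g' b) (d' b) ch2 r.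

Lemma focused2_self s g d a b C l E ch2 r :
  focused2 s g d a b C l E ch2 r -> build g d s = two C a (g a) (d a) l E b (g b) (d b) ch2 r.
Proof. intro H. now apply H. Qed.

Lemma build_focus2 s g d a b : NoDup (snames s) -> reach s a b -> a <> b ->
  exists C l E ch2 r, focused2 s g d a b C l E ch2 r.
Proof.
  intros ND Hr Hne. destruct (reach_split _ _ _ Hr Hne) as [K [l [K2 [ch2 [r ->]]]]].
  exists (bctx g d K), (map (build g d) l), (bctx g d K2), (map (build g d) ch2),
    (map (build g d) r).
  intros g' d' Hg Hd.
  assert (E : splug K (SNode a (l ++ splug K2 (SNode b ch2) :: r))
             = splug (scomp K (SCNode a l K2 r)) (SNode b ch2)) by now rewrite splug_scomp.
  rewrite E in *.
  rewrite (build_splug_focus _ _ _ g d g' d') by assumption.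
  now rewrite bctx_scomp.
Qed.

Definition formulas_at (f : label -> nat) (L : list lform) (n : nat) : list form :=
  map snd (filter (fun x => Nat.eqb (f (fst x)) n) L).

Lemma formulas_at_app f L1 L2 n :
  formulas_at f (L1 ++ L2) n = formulas_at f L1 n ++ formulas_at f L2 n.
Proof. unfold formulas_at. now rewrite filter_app, map_app. Qed.

Lemma formulas_at_cons_eq f x A L n :
  f x = n -> formulas_at f ((x,A) :: L) n = A :: formulas_at f L n.
Proof. intros <-. unfold formulas_at. simpl. now rewrite Nat.eqb_refl. Qed.

Lemma formulas_at_cons_ne f x A L n :
  f x <> n -> formulas_at f ((x,A) :: L) n = formulas_at f L n.
Proof. intros H. unfold formulas_at. simpl. now rewrite (proj2 (Nat.eqb_neq _ _) H). Qed.

Lemma in_formulas_at f L x A : In (x,A) L -> In A (formulas_at f L (f x)).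
Proof.
  intros H. apply in_map_iff. exists (x,A). split; [reflexivity|].
  apply filter_In. split; [assumption|]. apply Nat.eqb_refl.
Qed.

Lemma formulas_at_ext f f' L n :
  (forall x A, In (x,A) L -> f' x = f x) -> formulas_at f' L n = formulas_at f L n.
Proof.
  unfold formulas_at. intros H. f_equal. apply filter_ext_in.
  intros [x A] HxA. simpl. now rewrite (H x A HxA).
Qed.

Lemma formulas_at_nil f L n :
  (forall x A, In (x,A) L -> f x <> n) -> formulas_at f L n = [].
Proof.
  induction L as [|[x A] L IH]; intros H; [reflexivity|].
  rewrite formulas_at_cons_ne by (apply (H x A); now left).
  apply IH. intros y B HyB. apply (H y B). now right.
Qed.

Lemma formulas_at_mid f l1 l2 w X :
  formulas_at f (l1 ++ (w,X) :: l2) (f w) = formulas_at f l1 (f w) ++ X :: formulas_at f l2 (f w).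
Proof. now rewrite formulas_at_app, formulas_at_cons_eq. Qed.

Lemma formulas_at_prepend f w Ps L :
  formulas_at f (map (pair w) Ps ++ L) (f w) = Ps ++ formulas_at f L (f w).
Proof. induction Ps as [|P Ps IH]; [reflexivity|]. simpl. now rewrite formulas_at_cons_eq, IH. Qed.

Lemma formulas_at_replace f w Ps X l1 l2 m : m <> f w ->
  formulas_at f (map (pair w) Ps ++ l1 ++ l2) m = formulas_at f (l1 ++ (w,X) :: l2) m.
Proof.
  intros Hm. rewrite !formulas_at_app, formulas_at_cons_ne by congruence.
  rewrite (formulas_at_nil f (map (pair w) Ps)); [reflexivity|].
  intros x A (P & [= -> _] & _)%in_map_iff. congruence.
Qed.

Definition rel_embedded (s : skel) (f : label -> nat) (R : list rel_atom) : Prop :=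
  forall x y, In (x,y) R -> reach_or_eq s (f x) (f y).

Definition labels_embedded (s : skel) (f : label -> nat) (L : list lform) : Prop :=
  forall x A, In (x,A) L -> In (f x) (snames s).

(* [G0] and [D0] are fixed orderings of [G] and [D]: a rule that only permutes formulas
   then leaves the lists at all other nodes literally unchanged, as the nested rules,
   which act inside an unchanged context, require. *)
Definition translatable (R : list rel_atom) (G D : list lform) : Prop :=
  forall s f G0 D0, Permutation G G0 -> Permutation D D0 -> NoDup (snames s) ->
  rel_embedded s f R -> labels_embedded s f G0 -> labels_embedded s f D0 ->
  NProv (build (formulas_at f G0) (formulas_at f D0) s).

Lemma labels_embedded_cons s f x A L :
  In (f x) (snames s) -> labels_embedded s f L -> labels_embedded s f ((x,A) :: L).
Proof. intros Hx HL y B [[= -> ->]|H]; eauto. Qed.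

Lemma labels_embedded_prepend s f w X Ps l1 l2 :
  labels_embedded s f (l1 ++ (w,X) :: l2) -> labels_embedded s f (map (pair w) Ps ++ l1 ++ l2).
Proof.
  intros H x A HxA. apply in_app_or in HxA as [(P & [= -> _] & _)%in_map_iff|HxA].
  - eapply H, in_elt.
  - apply (H x A). apply in_app_or in HxA as [?|?]; apply in_or_app; simpl; auto.
Qed.

Lemma Permutation_cons_split {X} (G G0 G' : list X) x :
  Permutation G (x :: G') -> Permutation G G0 ->
  exists l1 l2, G0 = l1 ++ x :: l2 /\ Permutation G' (l1 ++ l2).
Proof.
  intros H1 H2.
  assert (Hin : In x G0) by (rewrite <- H2, H1; now left).
  destruct (in_split _ _ Hin) as [l1 [l2 ->]]. exists l1, l2. split; [reflexivity|].
  apply Permutation_cons_app_inv with x. now rewrite <- H1.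
Qed.

Lemma NProv_left_premise s f l1 l2 D0 w X Ps C chs :
  focused s (formulas_at f (l1 ++ (w,X) :: l2)) (formulas_at f D0) (f w) C chs ->
  NProv (build (formulas_at f (map (pair w) Ps ++ l1 ++ l2)) (formulas_at f D0) s) ->
  NProv (plug C (Node (f w) (Ps ++ formulas_at f l1 (f w) ++ formulas_at f l2 (f w))
                   (formulas_at f D0 (f w)) chs)).
Proof.
  intros Hfoc HX. rewrite Hfoc, formulas_at_prepend, formulas_at_app in HX;
    [exact HX|apply formulas_at_replace|reflexivity].
Qed.

Lemma NProv_right_premise s f G0 l1 l2 w X Ps C chs :
  focused s (formulas_at f G0) (formulas_at f (l1 ++ (w,X) :: l2)) (f w) C chs ->
  NProv (build (formulas_at f G0) (formulas_at f (map (pair w) Ps ++ l1 ++ l2)) s) ->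
  NProv (plug C (Node (f w) (formulas_at f G0 (f w))
                   (Ps ++ formulas_at f l1 (f w) ++ formulas_at f l2 (f w)) chs)).
Proof.
  intros Hfoc HX. rewrite Hfoc, formulas_at_prepend, formulas_at_app in HX;
    [exact HX|reflexivity|apply formulas_at_replace].
Qed.

Lemma translatable_orl R G G' D w A B : Permutation G ((w, Or A B) :: G') ->
  translatable R ((w,A) :: G') D -> translatable R ((w,B) :: G') D -> translatable R G D.
Proof.
  intros HP IH1 IH2 s f G0 D0 HG HD ND HR HLG HLD.
  destruct (Permutation_cons_split _ _ _ _ HP HG) as [l1 [l2 [-> Hl]]].
  destruct (build_focus s (formulas_at f (l1 ++ (w, Or A B) :: l2)) (formulas_at f D0) (f w) ND)
    as [C [chs Hfoc]]; [eapply HLG, in_elt|].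
  rewrite (focused_self _ _ _ _ _ _ Hfoc), formulas_at_mid.
  apply N_orl with (G' := formulas_at f l1 (f w) ++ formulas_at f l2 (f w)) (A := A) (B := B).
  - symmetry. apply Permutation_middle.
  - apply (NProv_left_premise _ _ _ _ _ _ _ [A] _ _ Hfoc), IH1;
      try assumption; [exact (perm_skip _ Hl)|exact (labels_embedded_prepend _ _ _ _ _ _ _ HLG)].
  - apply (NProv_left_premise _ _ _ _ _ _ _ [B] _ _ Hfoc), IH2;
      try assumption; [exact (perm_skip _ Hl)|exact (labels_embedded_prepend _ _ _ _ _ _ _ HLG)].
Qed.

Lemma translatable_orr R G D D' w A B : Permutation D ((w, Or A B) :: D') ->
  translatable R G ((w,A) :: (w,B) :: D') -> translatable R G D.
Proof.
  intros HP IH s f G0 D0 HG HD ND HR HLG HLD.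
  destruct (Permutation_cons_split _ _ _ _ HP HD) as [l1 [l2 [-> Hl]]].
  destruct (build_focus s (formulas_at f G0) (formulas_at f (l1 ++ (w, Or A B) :: l2)) (f w) ND)
    as [C [chs Hfoc]]; [eapply HLD, in_elt|].
  rewrite (focused_self _ _ _ _ _ _ Hfoc), formulas_at_mid.
  apply N_orr with (D' := formulas_at f l1 (f w) ++ formulas_at f l2 (f w)) (A := A) (B := B).
  - symmetry. apply Permutation_middle.
  - apply (NProv_right_premise _ _ _ _ _ _ _ [A; B] _ _ Hfoc), IH;
      try assumption; [exact (perm_skip _ (perm_skip _ Hl))
                      |exact (labels_embedded_prepend _ _ _ _ _ _ _ HLD)].
Qed.

Lemma translatable_andl R G G' D w A B : Permutation G ((w, And A B) :: G') ->
  translatable R ((w,A) :: (w,B) :: G') D -> translatable R G D.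
Proof.
  intros HP IH s f G0 D0 HG HD ND HR HLG HLD.
  destruct (Permutation_cons_split _ _ _ _ HP HG) as [l1 [l2 [-> Hl]]].
  destruct (build_focus s (formulas_at f (l1 ++ (w, And A B) :: l2)) (formulas_at f D0) (f w) ND)
    as [C [chs Hfoc]]; [eapply HLG, in_elt|].
  rewrite (focused_self _ _ _ _ _ _ Hfoc), formulas_at_mid.
  apply N_andl with (G' := formulas_at f l1 (f w) ++ formulas_at f l2 (f w)) (A := A) (B := B).
  - symmetry. apply Permutation_middle.
  - apply (NProv_left_premise _ _ _ _ _ _ _ [A; B] _ _ Hfoc), IH;
      try assumption; [exact (perm_skip _ (perm_skip _ Hl))
                      |exact (labels_embedded_prepend _ _ _ _ _ _ _ HLG)].
Qed.

Lemma translatable_andr R G D D' w A B : Permutation D ((w, And A B) :: D') ->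
  translatable R G ((w,A) :: D') -> translatable R G ((w,B) :: D') -> translatable R G D.
Proof.
  intros HP IH1 IH2 s f G0 D0 HG HD ND HR HLG HLD.
  destruct (Permutation_cons_split _ _ _ _ HP HD) as [l1 [l2 [-> Hl]]].
  destruct (build_focus s (formulas_at f G0) (formulas_at f (l1 ++ (w, And A B) :: l2)) (f w) ND)
    as [C [chs Hfoc]]; [eapply HLD, in_elt|].
  rewrite (focused_self _ _ _ _ _ _ Hfoc), formulas_at_mid.
  apply N_andr with (D' := formulas_at f l1 (f w) ++ formulas_at f l2 (f w)) (A := A) (B := B).
  - symmetry. apply Permutation_middle.
  - apply (NProv_right_premise _ _ _ _ _ _ _ [A] _ _ Hfoc), IH1;
      try assumption; [exact (perm_skip _ Hl)|exact (labels_embedded_prepend _ _ _ _ _ _ _ HLD)].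
  - apply (NProv_right_premise _ _ _ _ _ _ _ [B] _ _ Hfoc), IH2;
      try assumption; [exact (perm_skip _ Hl)|exact (labels_embedded_prepend _ _ _ _ _ _ _ HLD)].
Qed.

Lemma reach_or_eq_cases s a b : reach_or_eq s a b -> a = b \/ (a <> b /\ reach s a b).
Proof. intros [->|H]; [now left|]. destruct (Nat.eq_dec a b); [now left|now right]. Qed.

Lemma translatable_id R G D w u p :
  In (w,u) R -> In (w, Var p) G -> In (u, Var p) D -> translatable R G D.
Proof.
  intros Hwu HwG HuD s f G0 D0 HG HD ND HR HLG HLD.
  apply (Permutation_in _ HG) in HwG. apply (Permutation_in _ HD) in HuD.
  destruct (reach_or_eq_cases _ _ _ (HR w u Hwu)) as [Heq|[Hne Hr]].
  - destruct (build_focus s (formulas_at f G0) (formulas_at f D0) (f w) ND (HLG _ _ HwG))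
      as [C [chs Hfoc]].
    rewrite (focused_self _ _ _ _ _ _ Hfoc). apply N_id_same with p.
    + now apply in_formulas_at.
    + rewrite Heq. now apply in_formulas_at.
  - destruct (build_focus2 s (formulas_at f G0) (formulas_at f D0) _ _ ND Hr Hne)
      as [C [l [E [ch2 [r Hfoc]]]]].
    rewrite (focused2_self _ _ _ _ _ _ _ _ _ _ Hfoc).
    apply N_id_desc with p; now apply in_formulas_at.
Qed.

Lemma translatable_botl R G D w u : In (w,u) R -> In (w, Bot) G -> translatable R G D.
Proof.
  intros _ HwG s f G0 D0 HG HD ND HR HLG HLD.
  apply (Permutation_in _ HG) in HwG.
  destruct (build_focus s (formulas_at f G0) (formulas_at f D0) (f w) ND (HLG _ _ HwG))
    as [C [chs Hfoc]].
  rewrite (focused_self _ _ _ _ _ _ Hfoc). apply N_botl. now apply in_formulas_at.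
Qed.

Lemma translatable_ref R G D w : translatable ((w,w) :: R) G D -> translatable R G D.
Proof.
  intros IH s f G0 D0 HG HD ND HR HLG HLD. apply IH; try assumption.
  intros x y [[= -> ->]|H]; [now left|auto].
Qed.

Lemma translatable_tra R G D w u v : In (w,u) R -> In (u,v) R ->
  translatable ((w,v) :: R) G D -> translatable R G D.
Proof.
  intros Hwu Huv IH s f G0 D0 HG HD ND HR HLG HLD. apply IH; try assumption.
  intros x y [[= -> ->]|H]; [|auto].
  apply (reach_or_eq_trans _ _ (f u)); auto.
Qed.

Lemma reach_or_eq_in_snames s a b : reach_or_eq s a b -> In a (snames s) -> In b (snames s).
Proof. intros [<-|H] Ha; [assumption|exact (reach_in_snames _ _ _ H)]. Qed.

Section AddAtNode.
Variables (s : skel) (f : label -> nat) (G0 D0 : list lform) (x : label) (A : form).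

Lemma focused_cons_left a C chs : focused s (formulas_at f G0) (formulas_at f D0) a C chs ->
  f x = a -> build (formulas_at f ((x,A) :: G0)) (formulas_at f D0) s
             = plug C (Node a (A :: formulas_at f G0 a) (formulas_at f D0 a) chs).
Proof.
  intros Hfoc Hx. rewrite Hfoc, formulas_at_cons_eq; try easy.
  intros m Hm. apply formulas_at_cons_ne. congruence.
Qed.

Lemma focused_cons_right a C chs : focused s (formulas_at f G0) (formulas_at f D0) a C chs ->
  f x = a -> build (formulas_at f G0) (formulas_at f ((x,A) :: D0)) s
             = plug C (Node a (formulas_at f G0 a) (A :: formulas_at f D0 a) chs).
Proof.
  intros Hfoc Hx. rewrite Hfoc, formulas_at_cons_eq; try easy.
  intros m Hm. apply formulas_at_cons_ne. congruence.
Qed.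

Lemma focused2_cons_left a b C l E ch2 r :
  focused2 s (formulas_at f G0) (formulas_at f D0) a b C l E ch2 r -> f x = b ->
  build (formulas_at f ((x,A) :: G0)) (formulas_at f D0) s
  = two C a (formulas_at f G0 a) (formulas_at f D0 a) l E b
        (A :: formulas_at f G0 b) (formulas_at f D0 b) ch2 r.
Proof.
  intros Hfoc Hx. rewrite Hfoc, formulas_at_cons_eq; try easy.
  intros m Hm. apply formulas_at_cons_ne. congruence.
Qed.

Lemma focused2_cons_right a b C l E ch2 r :
  focused2 s (formulas_at f G0) (formulas_at f D0) a b C l E ch2 r -> f x = b ->
  build (formulas_at f G0) (formulas_at f ((x,A) :: D0)) s
  = two C a (formulas_at f G0 a) (formulas_at f D0 a) l E b
        (formulas_at f G0 b) (A :: formulas_at f D0 b) ch2 r.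
Proof.
  intros Hfoc Hx. rewrite Hfoc, formulas_at_cons_eq; try easy.
  intros m Hm. apply formulas_at_cons_ne. congruence.
Qed.
End AddAtNode.

Lemma translatable_impl R G D w u A B : In (w,u) R -> In (w, Imp A B) G ->
  translatable R ((u,B) :: G) D -> translatable R G ((u,A) :: D) -> translatable R G D.
Proof.
  intros Hwu HwG IH1 IH2 s f G0 D0 HG HD ND HR HLG HLD.
  apply (Permutation_in _ HG) in HwG.
  assert (Hw : In (f w) (snames s)) by exact (HLG _ _ HwG).
  assert (Hu : In (f u) (snames s)) by exact (reach_or_eq_in_snames _ _ _ (HR w u Hwu) Hw).
  specialize (IH1 s f ((u,B) :: G0) D0 (perm_skip _ HG) HD ND HR
                (labels_embedded_cons _ _ _ _ _ Hu HLG) HLD).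
  specialize (IH2 s f G0 ((u,A) :: D0) HG (perm_skip _ HD) ND HR HLG
                (labels_embedded_cons _ _ _ _ _ Hu HLD)).
  destruct (reach_or_eq_cases _ _ _ (HR w u Hwu)) as [Heq|[Hne Hr]].
  - destruct (build_focus s (formulas_at f G0) (formulas_at f D0) (f w) ND Hw) as [C [chs Hfoc]].
    rewrite (focused_self _ _ _ _ _ _ Hfoc). apply N_impl_same with A B.
    + now apply in_formulas_at.
    + now rewrite <- (focused_cons_left _ _ _ _ u B _ _ _ Hfoc).
    + now rewrite <- (focused_cons_right _ _ _ _ u A _ _ _ Hfoc).
  - destruct (build_focus2 s (formulas_at f G0) (formulas_at f D0) _ _ ND Hr Hne)
      as [C [l [E [ch2 [r Hfoc]]]]].
    rewrite (focused2_self _ _ _ _ _ _ _ _ _ _ Hfoc). apply N_impl_desc with A B.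
    + now apply in_formulas_at.
    + now rewrite <- (focused2_cons_left _ _ _ _ u B _ _ _ _ _ _ _ Hfoc).
    + now rewrite <- (focused2_cons_right _ _ _ _ u A _ _ _ _ _ _ _ Hfoc).
Qed.

Definition fresh_name (l : list nat) : nat := S (list_max l).

Lemma fresh_name_notin l : ~ In (fresh_name l) l.
Proof.
  intros H. assert (Hle : list_max l <= list_max l) by reflexivity.
  apply list_max_le, Forall_forall with (x := fresh_name l) in Hle; [|assumption].
  unfold fresh_name in Hle. lia.
Qed.

Definition relabel (f : label -> nat) (u : label) (n : nat) : label -> nat :=
  fun x => if Nat.eqb x u then n else f x.

Lemma relabel_eq f u n : relabel f u n u = n.
Proof. unfold relabel. now rewrite Nat.eqb_refl. Qed.

Lemma relabel_ne f u n x : x <> u -> relabel f u n x = f x.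
Proof. intros H. unfold relabel. now rewrite (proj2 (Nat.eqb_neq _ _) H). Qed.

Lemma labels_F_neq u L x A : ~ In u (labels_F L) -> In (x,A) L -> x <> u.
Proof. intros Hu HxA ->. apply Hu. exact (in_map fst _ _ HxA). Qed.

Lemma labels_R_neq u R x y : ~ In u (labels_R R) -> In (x,y) R -> x <> u /\ y <> u.
Proof.
  intros Hu Hxy. split; intros E; apply Hu, in_flat_map; exists (x,y); simpl; auto.
Qed.

Lemma labels_F_perm u L L' : Permutation L L' -> ~ In u (labels_F L) -> ~ In u (labels_F L').
Proof. intros HP Hu H. apply Hu. eapply Permutation_in; [|exact H]. now apply Permutation_map. Qed.

Lemma formulas_at_relabel_cons s f u n X L m :
  ~ In u (labels_F L) -> labels_embedded s f L -> ~ In n (snames s) ->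
  formulas_at (relabel f u n) ((u,X) :: L) m = if Nat.eqb m n then [X] else formulas_at f L m.
Proof.
  intros HuL HL Hn.
  assert (Hf : forall x A, In (x,A) L -> relabel f u n x = f x).
  { intros x A HxA. exact (relabel_ne _ _ _ _ (labels_F_neq _ _ _ _ HuL HxA)). }
  destruct (Nat.eqb_spec m n) as [->|Hm].
  - rewrite formulas_at_cons_eq by apply relabel_eq. f_equal.
    rewrite (formulas_at_ext f) by exact Hf. apply formulas_at_nil.
    intros x A HxA E. apply Hn. rewrite <- E. exact (HL x A HxA).
  - rewrite formulas_at_cons_ne by (rewrite relabel_eq; congruence).
    exact (formulas_at_ext f _ L m Hf).
Qed.

Lemma labels_embedded_relabel s s' f u n X L :
  (forall z, In z (snames s) -> In z (snames s')) -> In n (snames s') ->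
  ~ In u (labels_F L) -> labels_embedded s f L ->
  labels_embedded s' (relabel f u n) ((u,X) :: L).
Proof.
  intros Hsub Hn HuL HL x A [[= <- _]|HxA].
  - now rewrite relabel_eq.
  - rewrite relabel_ne by exact (labels_F_neq _ _ _ _ HuL HxA). exact (Hsub _ (HL x A HxA)).
Qed.

Lemma rel_embedded_relabel s s' f u n w R :
  (forall x y, reach s x y -> reach s' x y) -> reach s' (f w) n -> w <> u ->
  ~ In u (labels_R R) -> rel_embedded s f R ->
  rel_embedded s' (relabel f u n) ((w,u) :: R).
Proof.
  intros Hreach Hwn Hwu HuR HR x y [[= <- <-]|Hxy].
  - right. now rewrite relabel_eq, relabel_ne.
  - destruct (labels_R_neq _ _ _ _ HuR Hxy) as [Hx Hy].
    rewrite !relabel_ne by assumption.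
    destruct (HR x y Hxy) as [->|H]; [now left|right; auto].
Qed.

Lemma snames_add_leaf K a ch n :
  Permutation (snames (splug K (SNode a (SNode n [] :: ch)))) (n :: snames (splug K (SNode a ch))).
Proof.
  rewrite !snames_splug. simpl.
  replace (cnames K ++ a :: n :: flat_map snames ch)
    with ((cnames K ++ [a]) ++ n :: flat_map snames ch) by now rewrite <- app_assoc.
  rewrite <- Permutation_middle, <- app_assoc. reflexivity.
Qed.

Lemma NoDup_add_leaf K a ch n :
  NoDup (snames (splug K (SNode a ch))) -> ~ In n (snames (splug K (SNode a ch))) ->
  NoDup (snames (splug K (SNode a (SNode n [] :: ch)))).
Proof.
  intros ND Hn. apply (Permutation_NoDup (Permutation_sym (snames_add_leaf K a ch n))).
  now constructor.
Qed.

Lemma build_add_leaf K a ch n g d g' d' :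
  NoDup (snames (splug K (SNode a (SNode n [] :: ch)))) ->
  (forall m, m <> a -> m <> n -> g' m = g m /\ d' m = d m) ->
  build g' d' (splug K (SNode a (SNode n [] :: ch))) =
  plug (bctx g d K) (Node a (g' a) (d' a) (Node n (g' n) (d' n) [] :: map (build g d) ch)).
Proof.
  intros ND Hoff. destruct (NoDup_splug _ _ ND) as [ND1 Hdis].
  cbn [snames flat_map app] in ND1.
  apply NoDup_cons_iff in ND1 as [Ha ND1]. apply NoDup_cons_iff in ND1 as [Hn _].
  rewrite build_splug. cbn [build map]. f_equal; [|do 2 f_equal].
  - apply bctx_ext_in. intros m Hm. specialize (Hdis m).
    apply Hoff; intros ->; apply Hdis; simpl; auto.
  - apply map_build_ext_in. intros m Hm.
    apply Hoff; intros ->; simpl in *; auto.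
Qed.

Lemma NProv_impr_add_leaf K a ch n g d g' d' A B D' :
  NoDup (snames (splug K (SNode a ch))) -> ~ In n (snames (splug K (SNode a ch))) ->
  Permutation (d a) (Imp A B :: D') -> g' a = g a -> d' a = D' -> g' n = [A] -> d' n = [B] ->
  (forall m, m <> a -> m <> n -> g' m = g m /\ d' m = d m) ->
  NProv (build g' d' (splug K (SNode a (SNode n [] :: ch)))) ->
  NProv (build g d (splug K (SNode a ch))).
Proof.
  intros ND Hn HP Ega Eda Egn Edn Hoff HX.
  rewrite (build_add_leaf _ _ _ _ g d) in HX by auto using NoDup_add_leaf.
  rewrite Ega, Eda, Egn, Edn in HX.
  assert (Hfresh : ~ In n (names (build g d (splug K (SNode a ch))))) by now rewrite names_build.
  rewrite build_splug in Hfresh |- *. apply N_impr with D' n A B; assumption.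
Qed.

Lemma not_in_labels_F_remove u l1 x l2 :
  ~ In u (labels_F (l1 ++ x :: l2)) -> ~ In u (labels_F (l1 ++ l2)).
Proof. unfold labels_F. rewrite !map_app, !in_app_iff. simpl. tauto. Qed.

Lemma translatable_impr R G D D' w u A B : Permutation D ((w, Imp A B) :: D') ->
  ~ In u (labels_R R) -> ~ In u (labels_F G) -> ~ In u (labels_F D) ->
  translatable ((w,u) :: R) ((u,A) :: G) ((u,B) :: D') -> translatable R G D.
Proof.
  intros HP HuR HuG HuD IH s f G0 D0 HG HD ND HR HLG HLD.
  destruct (Permutation_cons_split _ _ _ _ HP HD) as [l1 [l2 [-> Hl]]].
  apply (labels_F_perm _ _ _ HG) in HuG. apply (labels_F_perm _ _ _ HD) in HuD.
  assert (Hwu : w <> u) by exact (labels_F_neq _ _ _ _ HuD (in_elt _ _ _)).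
  apply not_in_labels_F_remove in HuD.
  assert (HL12 : labels_embedded s f (l1 ++ l2)) by exact (labels_embedded_prepend _ _ _ _ [] _ _ HLD).
  assert (Hw : In (f w) (snames s)) by (eapply HLD, in_elt).
  destruct (splug_at_name _ _ Hw) as [K [ch ->]].
  set (s := splug K (SNode (f w) ch)) in *.
  set (n := fresh_name (snames s)).
  assert (Hn : ~ In n (snames s)) by apply fresh_name_notin.
  set (s' := splug K (SNode (f w) (SNode n [] :: ch))).
  assert (Hsub : forall z, In z (snames s) -> In z (snames s')).
  { intros z Hz. eapply Permutation_in; [symmetry; apply snames_add_leaf|now right]. }
  assert (Hn' : In n (snames s')) by (apply in_snames_splug; simpl; auto).
  assert (Hwn : Nat.eqb (f w) n = false) by (apply Nat.eqb_neq; congruence).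
  specialize (IH s' (relabel f u n) ((u,A) :: G0) ((u,B) :: l1 ++ l2)
                (perm_skip _ HG) (perm_skip _ Hl) (NoDup_add_leaf _ _ _ _ ND Hn)).
  apply (NProv_impr_add_leaf K (f w) ch n _ _ (formulas_at (relabel f u n) ((u,A) :: G0))
           (formulas_at (relabel f u n) ((u,B) :: l1 ++ l2)) A B
           (formulas_at f l1 (f w) ++ formulas_at f l2 (f w)) ND Hn).
  - rewrite formulas_at_mid. symmetry. apply Permutation_middle.
  - now rewrite (formulas_at_relabel_cons s), Hwn.
  - now rewrite (formulas_at_relabel_cons s), Hwn, formulas_at_app.
  - now rewrite (formulas_at_relabel_cons s), Nat.eqb_refl.
  - now rewrite (formulas_at_relabel_cons s), Nat.eqb_refl.
  - intros m Hm Hmn. rewrite !(formulas_at_relabel_cons s), (proj2 (Nat.eqb_neq _ _) Hmn) by assumption.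
    split; [reflexivity|exact (formulas_at_replace _ _ [] _ _ _ _ Hm)].
  - apply IH.
    + apply rel_embedded_relabel with s; auto.
      * intros x y Hxy. unfold s'. rewrite <- graft_at by exact ND. now apply reach_graft.
      * exists K, (SNode n [] :: ch). split; [reflexivity|simpl; auto].
    + now apply labels_embedded_relabel with s.
    + now apply labels_embedded_relabel with s.
Qed.

Lemma LProv_translatable R G D : LProv R G D -> translatable R G D.
Proof.
  induction 1; eauto using translatable_id, translatable_botl, translatable_impr,
    translatable_orl, translatable_orr, translatable_andl, translatable_andr,
    translatable_impl, translatable_ref, translatable_tra.
Qed.

Theorem mainTheorem9 : forall (A : form) (w : label),
  LProv [] [] [(w, A)] -> NProv (Node root_name [] [A] []).
Proof.
  intros A w H.
  apply (LProv_translatable _ _ _ H (SNode root_name []) (fun _ => root_name) [] [(w, A)]).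
  - reflexivity.
  - reflexivity.
  - repeat constructor; simpl; tauto.
  - intros x y [].
  - intros x B [].
  - intros x B _. now left.
Qed.
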